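(* Let $B$ be a unital $C^*$-algebra and let $X$ be a compact Hausdorff space. Fix finitely many points $s_1,\ldots,s_N\in X$. For each $i$, let $B_{s_i}$ be a unital $C^*$-subalgebra of $B$, and define $$A:=\{f\in C(X,B): f(s_i)\in B_{s_i}\text{ for each } i\in\{1,\ldots,N\}\}.$$ Also define $B_s:=B$ for $s\in X\setminus\{s_1,\ldots,s_N\}$. If $\phi$ is a character on $A$, then $\phi=\psi\circ\mathrm{ev}_s$ for some $s\in X$ and some character $\psi$ on $B_s$.
   Context: A character on a unital $C^*$-algebra is a unital $*$-homomorphism to $\mathbb{C}$. A unital $C^*$-subalgebra of $B$ contains the unit of $B$. $\mathrm{ev}_s:A\to B_s$ denotes evaluation $f\mapsto f(s)$. The points $s_1,\ldots,s_N$ are distinct. *)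

(* Defs.v *)
From HB Require Import structures.
From mathcomp Require Import all_boot all_order all_algebra.
From mathcomp Require Import complex.
From mathcomp Require Import all_classical all_reals all_analysis.

Set Implicit Arguments.
Unset Strict Implicit.
Unset Printing Implicit Defensive.

Import Order.TTheory GRing.Theory Num.Theory.
Import numFieldNormedType.Exports.

Local Open Scope classical_set_scope.
Local Open Scope ring_scope.

Reserved Notation "x ** y" (at level 40, left associativity).

(* Unital complex *-algebras.  The product is not inherited from MathComp's
   [algType], whose instances are nontrivial rings: the zero algebra is a
   unital C*-algebra, and it occurs as C(X, B) when X is empty. *)
HB.mixin Record isStarAlgebra (C : numClosedFieldType) A
    & GRing.Lmodule C A := {
  sone : A;
  smul : A -> A -> A;
  star : A -> A;
  smulA : associative smul;
  smul1l : left_id sone smul;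
  smul1r : right_id sone smul;
  smulDl : left_distributive smul +%R;
  smulDr : right_distributive smul +%R;
  smulZl : forall (a : C) (x y : A), smul (a *: x) y = a *: smul x y;
  smulZr : forall (a : C) (x y : A), smul x (a *: y) = a *: smul x y;
  starK : involutive star;
  starD : {morph star : x y / x + y};
  starM : forall x y : A, star (smul x y) = smul (star y) (star x);
  starZ : forall (a : C) (x : A), star (a *: x) = a^* *: star x
}.

#[short(type="starAlgType")]
HB.structure Definition StarAlgebra (C : numClosedFieldType) :=
  {A of GRing.Lmodule C A & isStarAlgebra C A}.

Notation "x ** y" := (smul x y) : ring_scope.

HB.mixin Record isCStarAlgebra (C : numClosedFieldType) A
    & StarAlgebra C A & CompleteNormedModule C A := {
  cstar_normM : forall x y : A, `|x ** y| <= `|x| * `|y|;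
  cstar_norm : forall x : A, `|star x ** x| = `|x| ^+ 2
}.

#[short(type="cstarAlgType")]
HB.structure Definition CStarAlgebra (C : numClosedFieldType) :=
  {A of StarAlgebra C A & CompleteNormedModule C A & isCStarAlgebra C A}.

(* Unital *-homomorphisms to C; the norm plays no role in this notion. *)
Definition is_character (C : numClosedFieldType) (A : starAlgType C)
    (phi : A -> C) : Prop :=
  [/\ scalar phi, phi sone = 1, {morph phi : x y / x ** y >-> x * y} &
      {morph phi : x / star x >-> x^*}].

Section fct_starAlgebra.
Variables (C : numClosedFieldType) (T : Type) (A : starAlgType C).
Implicit Types f g h : T -> A.

Let fone : T -> A := fun=> sone.
Let fmul f g : T -> A := fun t => f t ** g t.
Let fstar f : T -> A := fun t => star (f t).

Let fmulA : associative fmul.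
Proof. by move=> f g h; apply/funext => t; apply: smulA. Qed.
Let fmul1l : left_id fone fmul.
Proof. by move=> f; apply/funext => t; apply: smul1l. Qed.
Let fmul1r : right_id fone fmul.
Proof. by move=> f; apply/funext => t; apply: smul1r. Qed.
Let fmulDl : left_distributive fmul +%R.
Proof. by move=> f g h; apply/funext => t; apply: smulDl. Qed.
Let fmulDr : right_distributive fmul +%R.
Proof. by move=> f g h; apply/funext => t; apply: smulDr. Qed.
Let fmulZl (a : C) f g : fmul (a *: f) g = a *: fmul f g.
Proof. by apply/funext => t; apply: smulZl. Qed.
Let fmulZr (a : C) f g : fmul f (a *: g) = a *: fmul f g.
Proof. by apply/funext => t; apply: smulZr. Qed.
Let fstarK : involutive fstar.
Proof. by move=> f; apply/funext => t; apply: starK. Qed.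
Let fstarD : {morph fstar : f g / f + g}.
Proof. by move=> f g; apply/funext => t; apply: starD. Qed.
Let fstarM f g : fstar (fmul f g) = fmul (fstar g) (fstar f).
Proof. by apply/funext => t; apply: starM. Qed.
Let fstarZ (a : C) f : fstar (a *: f) = a^* *: fstar f.
Proof. by apply/funext => t; apply: starZ. Qed.

HB.instance Definition _ := isStarAlgebra.Build C (T -> A)
  fmulA fmul1l fmul1r fmulDl fmulDr fmulZl fmulZr
  fstarK fstarD fstarM fstarZ.

Definition fct_starAlg : starAlgType C := StarAlgebra.clone C (T -> A) _.

End fct_starAlgebra.

Record starSubalg (C : numClosedFieldType) (A : starAlgType C) := StarSubalg {
  starSubalg_set :> set A;
  starSubalg1 : starSubalg_set sone;
  starSubalgD : forall x y,
    starSubalg_set x -> starSubalg_set y -> starSubalg_set (x + y);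
  starSubalgM : forall x y,
    starSubalg_set x -> starSubalg_set y -> starSubalg_set (x ** y);
  starSubalgZ : forall (a : C) x, starSubalg_set x -> starSubalg_set (a *: x);
  starSubalg_star : forall x, starSubalg_set x -> starSubalg_set (star x)
}.

Record cstarSubalg (C : numClosedFieldType) (B : cstarAlgType C) :=
  CStarSubalg {
  cstarSubalg_sub :> starSubalg B;
  cstarSubalg_closed : closed (cstarSubalg_sub : set B)
}.

Section starSubalg_type.
Variables (C : numClosedFieldType) (A : starAlgType C) (S : starSubalg A).

Definition starSubalg_pred : {pred A} := fun x => x \in (S : set A).

Definition starSubalg_type : Type := {x : A | x \in starSubalg_pred}.

HB.instance Definition _ := SubType.on starSubalg_type.
HB.instance Definition _ := [Choice of starSubalg_type by <:].

Let submod_closed_S : submod_closed starSubalg_pred.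
Proof.
split=> [|a x y /set_mem Sx /set_mem Sy]; apply/mem_set.
  by rewrite -(scale0r sone); apply/starSubalgZ/starSubalg1.
by apply: starSubalgD => //; apply: starSubalgZ.
Qed.

HB.instance Definition _ :=
  GRing.isSubmodClosed.Build C A starSubalg_pred submod_closed_S.

HB.instance Definition _ := [SubChoice_isSubLmodule of starSubalg_type by <:].

Implicit Types u v w : starSubalg_type.

Let sub_one : starSubalg_type := exist _ sone (mem_set (starSubalg1 S)).
Let sub_mul u v : starSubalg_type := exist _ (val u ** val v)
  (mem_set (starSubalgM (set_mem (valP u)) (set_mem (valP v)))).
Let sub_star u : starSubalg_type := exist _ (star (val u))
  (mem_set (starSubalg_star (set_mem (valP u)))).

Let sub_mulA : associative sub_mul.
Proof. by move=> u v w; apply/val_inj; apply: smulA. Qed.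
Let sub_mul1l : left_id sub_one sub_mul.
Proof. by move=> u; apply/val_inj; apply: smul1l. Qed.
Let sub_mul1r : right_id sub_one sub_mul.
Proof. by move=> u; apply/val_inj; apply: smul1r. Qed.
Let sub_mulDl : left_distributive sub_mul +%R.
Proof. by move=> u v w; apply/val_inj; apply: smulDl. Qed.
Let sub_mulDr : right_distributive sub_mul +%R.
Proof. by move=> u v w; apply/val_inj; apply: smulDr. Qed.
Let sub_mulZl (a : C) u v : sub_mul (a *: u) v = a *: sub_mul u v.
Proof. by apply/val_inj; apply: smulZl. Qed.
Let sub_mulZr (a : C) u v : sub_mul u (a *: v) = a *: sub_mul u v.
Proof. by apply/val_inj; apply: smulZr. Qed.
Let sub_starK : involutive sub_star.
Proof. by move=> u; apply/val_inj; apply: starK. Qed.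
Let sub_starD : {morph sub_star : u v / u + v}.
Proof. by move=> u v; apply/val_inj; apply: starD. Qed.
Let sub_starM u v : sub_star (sub_mul u v) = sub_mul (sub_star v) (sub_star u).
Proof. by apply/val_inj; apply: starM. Qed.
Let sub_starZ (a : C) u : sub_star (a *: u) = a^* *: sub_star u.
Proof. by apply/val_inj; apply: starZ. Qed.

HB.instance Definition _ := isStarAlgebra.Build C starSubalg_type
  sub_mulA sub_mul1l sub_mul1r sub_mulDl sub_mulDr sub_mulZl sub_mulZr
  sub_starK sub_starD sub_starM sub_starZ.

End starSubalg_type.

Section cstar_continuity.
Variables (C : numClosedFieldType) (B : cstarAlgType C).
Implicit Types x y : B.

Lemma starN x : star (- x) = - star x.
Proof. by rewrite -scaleN1r starZ rmorphN rmorph1 scaleN1r. Qed.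

Lemma starB x y : star (x - y) = star x - star y.
Proof. by rewrite starD starN. Qed.

Lemma cstar_norm_star x : `|star x| = `|x|.
Proof.
have le z : `|z| <= `|star z|.
  have [->|z0] := eqVneq z 0; first by rewrite normr0.
  have z_gt0 : 0 < `|z| by rewrite normr_gt0.
  rewrite -(ler_pM2r z_gt0) -expr2 -cstar_norm.
  exact: cstar_normM.
by apply/eqP; rewrite eq_le le andbT -{2}(starK x) le.
Qed.

Lemma star_continuous : continuous (@star C B).
Proof.
move=> x; apply/cvgrPdist_lt => e e0.
near=> y; rewrite -starB cstar_norm_star.
by near: y; apply: cvgr_dist_lt.
Unshelve. all: by end_near. Qed.

Lemma smulBl x y z : (x - y) ** z = x ** z - y ** z.
Proof. by rewrite smulDl -scaleN1r smulZl scaleN1r. Qed.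

Lemma smulBr x y z : x ** (y - z) = x ** y - x ** z.
Proof. by rewrite smulDr -scaleN1r smulZr scaleN1r. Qed.

Lemma smul_continuous : continuous (fun z : B * B => z.1 ** z.2).
Proof.
move=> [/= k x]; apply/cvgrPdist_lt => _/posnumP[e]; near +oo_C => M.
near=> l z => /=; have M0 : 0 < M by [].
rewrite (@distm_lt_split _ _ (k ** z)) // -?(smulBr, smulBl).
  rewrite (le_lt_trans (cstar_normM _ _)) //.
  rewrite (@le_lt_trans _ _ (M * `|x - z|)) ?ler_wpM2r -?ltr_pdivlMl//.
  by near: z; apply: cvgr_dist_lt; rewrite // mulr_gt0 ?invr_gt0.
rewrite (le_lt_trans (cstar_normM _ _)) //.
rewrite (@le_lt_trans _ _ (`|k - l| * M)) ?ler_wpM2l -?ltr_pdivlMr//.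
  by near: z; near: M; apply: cvg_bounded (@cvg_refl _ _).
by near: l; apply: cvgr_dist_lt; rewrite // divr_gt0.
Unshelve. all: by end_near. Qed.

End cstar_continuity.

Section cstarSubalg_full.
Variables (C : numClosedFieldType) (B : cstarAlgType C).

Definition starSubalg_full : starSubalg B :=
  @StarSubalg C B [set: B] I (fun _ _ _ _ => I) (fun _ _ _ _ => I)
    (fun _ _ _ => I) (fun _ _ => I).

Definition cstarSubalg_full : cstarSubalg B :=
  @CStarSubalg C B starSubalg_full closedT.

End cstarSubalg_full.

Section constrained_functions.
Variables (C : numClosedFieldType) (B : cstarAlgType C) (X : topologicalType).
Variables (N : nat) (s : 'I_N -> X) (Bs : 'I_N -> cstarSubalg B).

Definition constrained_set : set (X -> B) :=
  [set f | continuous f /\ forall i, (Bs i : set B) (f (s i))].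

(* The algebra A, as a unital *-subalgebra of the algebra of all functions
   from X to B with pointwise operations. *)
Program Definition constrained : starSubalg (fct_starAlg X B) :=
  StarSubalg (starSubalg_set := constrained_set : set (fct_starAlg X B))
    _ _ _ _ _.
Next Obligation.
split=> [|i]; [exact: cst_continuous|exact: starSubalg1].
Qed.
Next Obligation.
move=> f g [cf Bf] [cg Bg]; split=> [x|i]; last exact: starSubalgD.
exact: cvgD (cf x) (cg x).
Qed.
Next Obligation.
move=> f g [cf Bf] [cg Bg]; split=> [x|i]; last exact: starSubalgM.
exact: (cvg_comp2 (cf x) (cg x) (@smul_continuous C B (f x, g x))).
Qed.
Next Obligation.
move=> a f [cf Bf]; split=> [x|i]; last exact: starSubalgZ.
exact: cvgZl_tmp (cf x).
Qed.
Next Obligation.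
move=> f [cf Bf]; split=> [x|i]; last exact: starSubalg_star.
exact: (cvg_comp _ _ (cf x) (@star_continuous C B (f x))).
Qed.

(* B_x: the algebra attached to x if x is one of the points s i (unambiguous
   when s is injective), and B otherwise. *)
Definition fiber (x : X) : cstarSubalg B :=
  if [pick i | s i == x] is Some i then Bs i else cstarSubalg_full B.

Lemma ev_subproof (x : X) (f : starSubalg_type constrained) :
  val f x \in starSubalg_pred (fiber x).
Proof.
have [_ Bf] := set_mem (valP f).
rewrite /fiber; apply/mem_set; case: pickP => [i /eqP <-|_]; last exact: I.
exact: Bf.
Qed.

Definition ev (x : X) (f : starSubalg_type constrained) :
    starSubalg_type (fiber x) :=
  exist _ (val f x) (ev_subproof x f).

End constrained_functions.

Arguments ev {C B X N} s Bs x f.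

(* Main.v *)
Require Import Defs.
From mathcomp Require Import all_boot all_order all_algebra.
From mathcomp Require Import complex.
From mathcomp Require Import all_classical all_reals all_analysis.

(** Scalar functions h . 1 meet every constraint, since each B_{s_i} contains
    the unit of B.  So h |-> h . 1 maps C(X) into A, and a character phi of A
    restricts along it to a character of C(X).  On a compact space the latter
    is evaluation at a point x, because a proper ideal of C(X) has a common
    zero ([ideal_common_zero], [character_scalar_section]).

    It remains to see that phi f depends on f x only, that is, phi f = 0 as
    soon as f x = 0.  This is purely algebraic: writing |f| for the function
    y |-> |f y|, the square f ** f is the product of |f|^-1 (f ** f), which is
    a continuous element of A once it is given the value 0 at the zeros of f,
    and of the scalar function |f|, which phi sends to |f x| = 0
    ([square_factor], [character_local]).  Hence (phi f)^2 = 0.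

    Finally ev_x maps A onto B_x, since b in B_x is the value at x of h . b for
    a Urysohn function h with h x = 1 that vanishes at the points s_i other
    than x ([ev_surjective]).  So phi, being trivial on the kernel of ev_x,
    descends to a character of B_x ([character_factor]). *)

Import Order.TTheory GRing.Theory Num.Theory.
Import numFieldNormedType.Exports.

Set Implicit Arguments.
Unset Strict Implicit.
Unset Printing Implicit Defensive.

Local Open Scope classical_set_scope.
Local Open Scope ring_scope.

(** * Zeros of ideals of continuous functions, and bump functions *)

Lemma conj_continuous (C : numClosedFieldType) :
  continuous (fun z : C => z^* : C).
Proof.
move=> z; apply/(@cvgrPdist_lt C C^o _ (nbhs z)) => e e0.
near=> w; rewrite -rmorphB norm_conjC.
by near: w; exact: nbhsx_ballx.
Unshelve. all: by end_near. Qed.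

Lemma real_complex_continuous (R : realType) :
  continuous (fun r : R => r%:C%C : (R[i] : numClosedFieldType)).
Proof.
move=> r.
apply/(@cvgrPdist_lt _ (R[i] : numClosedFieldType)^o _ (nbhs r)) => e e0.
(* A positive complex number is real, so e is the image of its real part. *)
have eE : (complex.Re e)%:C%C = e by apply: RRe_real; apply: gtr0_real.
have Re0 : 0 < complex.Re e by rewrite -ltcR eE.
near=> t; rewrite -rmorphB normc_def /= expr0n addr0 sqrtr_sqr -eE ltcR.
by near: t; exact: nbhsx_ballx.
Unshelve. all: by end_near. Qed.

(** The zero sets of the members of I form a filter base: |h|^2 + |k|^2 is in I
    and vanishes exactly where h and k both do, and a member without zeros is
    invertible, which would put 1 in I.  Zero sets being closed, a cluster
    point of this filter lies in all of them.  Properness also excludes the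
    empty space, on which 0 = 1. *)
Lemma ideal_common_zero (C : numClosedFieldType) (X : topologicalType)
    (I : set (X -> C)) :
  compact [set: X] ->
  (forall h, I h -> continuous h) ->
  I (fun=> 0) ->
  (forall h k, I h -> I k -> I (fun y => h y + k y)) ->
  (forall h k : X -> C, continuous h -> I k -> I (fun y => h y * k y)) ->
  ~ I (fun=> 1) ->
  exists x, forall h, I h -> h x = 0.
Proof.
move=> cX Ic I0 ID IM I1.
pose Z (h : X -> C) : set X := [set y | h y = 0].
have filterZ : Filter (filter_from I Z).
  apply: filter_from_filter; first by exists (fun=> 0).
  move=> h k Ih Ik; exists (fun y => (h y)^* * h y + (k y)^* * k y).
    have Iconj g : I g -> I (fun y => (g y)^* * g y).
      move=> Ig; apply: IM => // y.
      exact: (cvg_comp _ _ (Ic _ Ig y) (@conj_continuous C (g y))).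
    by apply: ID; apply: Iconj.
  move=> y /= /eqP; rewrite ![_^* * _]mulrC -!normCK.
  rewrite paddr_eq0 ?exprn_ge0// !expf_eq0 /= !normr_eq0.
  by case/andP => /eqP hy /eqP ky.
have properZ : ProperFilter (filter_from I Z).
  apply: filter_from_proper => h Ih; apply: contrapT => Zh; apply: I1.
  have h0 y : h y != 0 by apply/eqP => hy; apply: Zh; exists y.
  have -> : (fun=> 1) = (fun y => (h y)^-1 * h y).
    by apply/funext => y; rewrite mulVf.
  by apply: IM => // y; apply: cvgV => //; apply: Ic.
have [|x [_ clx]] := cX _ properZ; first by exists (fun=> 0).
exists x => h Ih.
have closedZ : closed (Z h).
  rewrite (_ : Z h = h @^-1` [set 0]); last by [].
  apply: closed_comp; first by move=> y _; apply: Ic.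
  exact: (accessible_closed_set1
    (hausdorff_accessible (@norm_hausdorff C C^o))).
by apply: closedZ => V xV; apply: clx => //; exists h.
Qed.

Lemma finite_set_bump (R : realType) (X : topologicalType) (F : set X) (x : X) :
  compact [set: X] -> hausdorff_space X -> finite_set F -> ~ F x ->
  exists h : X -> (R[i] : numClosedFieldType),
    [/\ continuous h, h x = 1 & forall y, F y -> h y = 0].
Proof.
move=> cX hX finF Fx.
have finite_closed :=
  accessible_finite_set_closed.1 (hausdorff_accessible hX).
have [|g [cg g0 g1 _]] := @urysohn_ext_itv X R (compact_normal hX cX) F [set x]
    0 1 (finite_closed _ finF) (finite_closed _ (finite_set1 x)) _ ltr01.
  by apply/seteqP; split => // y [Fy /= yx]; apply: Fx; rewrite -yx.
exists (fun y => (g y)%:C%C); split.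
- move=> y; exact: (cvg_comp _ _ (cg y) (@real_complex_continuous R (g y))).
- by rewrite (g1 (g x)) //; exists x.
- by move=> y Fy; rewrite (g0 (g y)) //; exists y.
Qed.

(** * Characters of the algebra of constrained functions *)

(** The character induced on A' is phi composed with any set-theoretic section
    of p; triviality of phi on the kernel makes the section immaterial. *)
Lemma character_factor (C : numClosedFieldType) (A A' : starAlgType C)
    (p : A -> A') (phi : A -> C) :
  linear p -> p sone = sone -> {morph p : f g / f ** g} ->
  {morph p : f / star f} ->
  (forall b, exists f, p f = b) ->
  is_character phi -> (forall f, p f = 0 -> phi f = 0) ->
  exists psi : A' -> C, is_character psi /\ phi = psi \o p.
Proof.
move=> plin p1 pM pstar psurj [philin phi1 phiM phistar] kerp.
have [sec secK] := choice psurj.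
have secE f : phi (sec (p f)) = phi f.
  have : phi (-1 *: f + sec (p f)) = 0.
    by apply: kerp; rewrite plin secK scaleN1r addNr.
  by rewrite philin mulN1r addrC => /subr0_eq.
exists (phi \o sec); split; last by apply/funext => f /=; rewrite secE.
split => [a b c| |b c|b] /=.
- by rewrite -{1}(secK b) -{1}(secK c) -plin secE philin.
- by rewrite -p1 secE.
- by rewrite -{1}(secK b) -{1}(secK c) -pM secE phiM.
- by rewrite -{1}(secK b) -pstar secE phistar.
Qed.

(** At a zero of f the quotient is 0 because 0^-1 = 0; it is continuous there
    because its norm is at most |f|. *)
Lemma square_over_norm_continuous (C : numClosedFieldType)
    (B : cstarAlgType C) (X : topologicalType) (f : X -> B) : continuous f ->
  continuous (fun y => `|f y|^-1 *: (f y ** f y)).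
Proof.
move=> cf y; have [fy0|fy0] := eqVneq (f y) 0; last first.
  apply: cvgZ; last exact: (cvg_comp2 (cf y) (cf y)
    (@smul_continuous C B (f y, f y))).
  by apply: cvgV; [rewrite normr_eq0|apply: cvg_norm; apply: cf].
rewrite /continuous_at /= fy0 normr0 invr0 scale0r; apply/cvgrPdist_le => e e0.
near=> z; rewrite sub0r normrN normrZ normfV normr_id.
have [->|fz0] := eqVneq (f z) 0; first by rewrite normr0 invr0 mul0r ltW.
apply: (@le_trans _ _ `|f z|).
  by rewrite ler_pdivrMl ?normr_gt0// cstar_normM.
rewrite -normrN -sub0r -fy0.
by near: z; apply: cvgr_dist_le (cf y) _ e0.
Unshelve. all: by end_near. Qed.

Section constrained_characters.
Variables (C : numClosedFieldType) (B : cstarAlgType C) (X : topologicalType).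
Variables (N : nat) (s : 'I_N -> X) (Bs : 'I_N -> cstarSubalg B).

Local Notation A := (starSubalg_type (constrained s Bs)).

Lemma constrained_exists (f : X -> B) : constrained_set s Bs f ->
  exists F : A, forall y, val F y = f y.
Proof. by move=> cf; exists (exist _ f (mem_set cf)). Qed.

(** The function h . 1.  It is made total in h, with junk value 0 when h . 1 is
    not in A, so that no continuity proof has to be carried along. *)
Definition scalar_section (h : X -> C) : A :=
  insubd (0 : A) ((fun y => h y *: sone) : fct_starAlg X B).

Lemma scalar_sectionE h : continuous h ->
  val (scalar_section h) = (fun y => h y *: sone) :> (X -> B).
Proof.
move=> ch; rewrite insubdK //; apply/mem_set; split=> [y|i].
  by apply: cvgZr_tmp; apply: ch.
exact/starSubalgZ/starSubalg1.
Qed.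

Lemma scalar_section1 : scalar_section (fun=> 1) = sone.
Proof.
apply/val_inj/funext => y.
by rewrite scalar_sectionE ?scale1r//; exact: cst_continuous.
Qed.

Lemma scalar_section_linear (a : C) (h k : X -> C) :
  continuous h -> continuous k ->
  scalar_section (fun y => a * h y + k y) =
  a *: scalar_section h + scalar_section k.
Proof.
move=> ch ck; apply/val_inj/funext => y.
transitivity (a *: val (scalar_section h) y + val (scalar_section k) y) => //.
rewrite !scalar_sectionE //; first by rewrite scalerDl scalerA.
by move=> z; apply: cvgD (ck z); apply: cvgM (ch z); apply: cvg_cst.
Qed.

Lemma scalar_sectionM (h k : X -> C) : continuous h -> continuous k ->
  scalar_section (fun y => h y * k y) = scalar_section h ** scalar_section k.
Proof.
move=> ch ck; apply/val_inj/funext => y.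
transitivity (val (scalar_section h) y ** val (scalar_section k) y) => //.
rewrite !scalar_sectionE //; first by rewrite smulZl smul1l scalerA.
by move=> z; apply: cvgM (ch z) (ck z).
Qed.

(** Squaring makes it possible to divide by |f| while staying continuous; f
    itself would only allow division by the square root of |f|.  The quotient
    still satisfies the constraints, being at each point a scalar multiple of
    f y ** f y. *)
Lemma square_factor (f : A) :
  exists g : A, f ** f = g ** scalar_section (fun y => `|val f y|).
Proof.
have [cf Bf] := set_mem (valP f).
have [|g gE] := @constrained_exists
  (fun y => `|val f y|^-1 *: (val f y ** val f y)).
  split; first exact: square_over_norm_continuous.
  by move=> i; apply/starSubalgZ/starSubalgM.
exists g; apply/val_inj/funext => y.
transitivity (val g y ** val (scalar_section (fun y => `|val f y|)) y) => //.
rewrite scalar_sectionE; last by move=> z; apply: cvg_norm; apply: cf.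
rewrite gE smulZr smul1r scalerA.
have [fy0|fy0] := eqVneq (val f y) 0; last by rewrite mulfV ?normr_eq0// scale1r.
rewrite -[LHS]/(val f y ** val f y) fy0.
by rewrite -(scale0r (sone : B)) smulZl !scale0r scaler0.
Qed.

Variable phi : A -> C.
Hypothesis phi_char : is_character phi.

(** The point x is a common zero of the ideal of all h with phi (h . 1) = 0,
    which contains h - phi (h . 1) for every h. *)
Lemma character_scalar_section : compact [set: X] ->
  exists x, forall h, continuous h -> phi (scalar_section h) = h x.
Proof.
move=> cX; have [philin phi1 phiM _] := phi_char.
have phi0 : phi 0 = 0.
  by have := philin (-1) 0 0; rewrite scaleN1r addNr mulN1r addNr.
have ss0 : scalar_section (fun=> 0) = 0.
  apply/val_inj/funext => y.
  by rewrite scalar_sectionE ?scale0r//; exact: cst_continuous.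
pose I := [set h : X -> C | continuous h /\ phi (scalar_section h) = 0].
have [h []//| | | | |x Ix] := @ideal_common_zero C X I cX.
- by split; [exact: cst_continuous|rewrite ss0].
- move=> h k [ch h0] [ck k0]; split.
    by move=> y; apply: cvgD (ch y) (ck y).
  rewrite (_ : (fun y => _) = (fun y => 1 * h y + k y)); last first.
    by apply/funext => y; rewrite mul1r.
  by rewrite scalar_section_linear// philin h0 k0 mulr0 addr0.
- move=> h k ch [ck k0]; split; first by move=> y; apply: cvgM (ch y) (ck y).
  by rewrite scalar_sectionM// phiM k0 mulr0.
- by case=> _; rewrite scalar_section1 phi1 => /eqP; rewrite oner_eq0.
exists x => h ch; set c := phi _.
have : I (fun y => - c * 1 + h y).
  split.
    by move=> y; apply: cvgD (ch y); apply: cvg_cst.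
  rewrite scalar_section_linear//; last exact: cst_continuous.
  by rewrite philin scalar_section1 phi1 mulr1 addNr.
by move/Ix; rewrite mulr1 addrC => /subr0_eq.
Qed.

(** By [square_factor], (phi f)^2 = phi g * |f x| for some g in A. *)
Lemma character_local x :
  (forall h, continuous h -> phi (scalar_section h) = h x) ->
  forall f : A, val f x = 0 -> phi f = 0.
Proof.
move=> phix f fx0; have [_ _ phiM _] := phi_char.
have [cf _] := set_mem (valP f).
have [g fgE] := square_factor f.
apply/eqP; rewrite -[_ == _]orbb -mulf_eq0 -phiM fgE phiM phix.
  by rewrite fx0 normr0 mulr0.
by move=> z; apply: cvg_norm; apply: cf.
Qed.

End constrained_characters.

(** * Evaluation at a point *)

Lemma fiber_node (C : numClosedFieldType) (B : cstarAlgType C)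
    (X : topologicalType) (N : nat) (s : 'I_N -> X)
    (Bs : 'I_N -> cstarSubalg B) (i : 'I_N) :
  injective s -> fiber s Bs (s i) = Bs i.
Proof.
move=> s_inj; rewrite /fiber; case: pickP => [j /eqP /s_inj -> //|/(_ i)].
by rewrite eqxx.
Qed.

(** Multiplying b by a bump function centred at x keeps the value at x and
    meets every constraint: h . b vanishes at the s_i other than x, and where
    s_i = x its value is b, which lies in B_x. *)
Lemma ev_surjective (R : realType) (B : cstarAlgType R[i])
    (X : topologicalType) (N : nat) (s : 'I_N -> X)
    (Bs : 'I_N -> cstarSubalg B) (x : X) :
  compact [set: X] -> hausdorff_space X -> injective s ->
  forall b, exists f, ev s Bs x f = b.
Proof.
move=> cX hX s_inj b.
have [||h [ch hx hs]] := @finite_set_bump R X (range s `\ x) x cX hX.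
- exact/finite_setD/finite_image/finite_finset.
- by case=> _ /=; apply.
have [|f fE] := @constrained_exists _ B X N s Bs (fun y => h y *: val b).
  split=> [y|i]; first by apply: cvgZr_tmp; apply: ch.
  have [six|six] := eqVneq (s i) x.
    rewrite six hx scale1r.
    have sub v : (fiber s Bs x : set B) v -> (Bs i : set B) v.
      by rewrite -six fiber_node.
    exact/sub/set_mem/(valP b).
  rewrite hs; last by split; [exists i|apply/eqP].
  by rewrite scale0r -(scale0r (sone : B)); apply/starSubalgZ/starSubalg1.
by exists f; apply/val_inj; rewrite /= fE hx scale1r.
Qed.

Theorem proposition4p7 (R : realType) (B : cstarAlgType R[i])
    (X : topologicalType) (X_compact : compact [set: X])
    (X_hausdorff : hausdorff_space X)
    (N : nat) (s : 'I_N -> X) (s_inj : injective s)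
    (Bs : 'I_N -> cstarSubalg B)
    (phi : starSubalg_type (constrained s Bs) -> R[i])
    (phi_char : is_character phi) :
  exists (x : X) (psi : starSubalg_type (fiber s Bs x) -> R[i]),
    is_character psi /\ phi = psi \o ev s Bs x.
Proof.
have [x phix] := character_scalar_section phi_char X_compact.
exists x; apply: (character_factor _ _ _ _ _ phi_char).
- by move=> a f g; apply/val_inj.
- exact/val_inj.
- by move=> f g; apply/val_inj.
- by move=> f; apply/val_inj.
- exact: ev_surjective.
- move=> f fx0; apply: (character_local phi_char phix).
  exact: (congr1 val fx0).
Qed.
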